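(* Let $\beta: I\to M\subset G^3$ be a unit-speed curve on a surface $M$ in the Galilean space $G^3$, with geodesic curvature $\kappa_g$, which is an asymptotic curve ($\kappa_n\equiv0$) and an anti-Salkowski curve (its torsion $\tau$ is constant and its curvature $\kappa$ is not constant). Then there are real constants $d,d_1$ such that, for a suitable choice of antiderivatives, $$\beta(x)=\Bigg(x,\ \int\!\!\int\kappa_g(x)\sin(dx+d_1)\,dx\,dx,\ \int\!\!\int\kappa_g(x)\cos(dx+d_1)\,dx\,dx\Bigg),$$ where inside the sine and cosine $dx$ denotes the product of the constant $d$ and the variable $x$.
   Context: The Galilean space $G^3$ is $\mathbb R^3$ with the scalar product $\mathbf v\cdot_G\mathbf w=v_1w_1$ if $v_1\ne0$ or $w_1\neq 0$, and $\mathbf v\cdot_G\mathbf w=v_2w_2+v_3w_3$ if $v_1=w_1=0$; the norm is $\|\mathbf v\|_G=\sqrt{|\mathbf v\cdot_G\mathbf v|}$ and the cross product is $\mathbf v\times_G\mathbf w=(0,\,v_3w_1-v_1w_3,\,v_1w_2-v_2w_1)$. A vector is isotropic if its first component is $0$. All objects are smooth and $I\subset\mathbb R$ is an open interval. $M$ is an oriented surface with local parametrizations $\phi(u,v)$ such that the first components of $\phi_u,\phi_v$ are not both zero; its unit normal is the isotropic vector field $\mathbf n=\pm\,\phi_u\times_G\phi_v/\|\phi_u\times_G\phi_v\|_G$ (sign fixed by the orientation). A unit-speed curve (parametrized by arc length) is one of the form $\beta(x)=(x,y(x),z(x))$, $x\in I$. Its curvature is $\kappa=\|\beta''\|_G$,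 assumed positive, and its torsion is $\tau=\det(\beta',\beta'',\beta''')/\kappa^2$. Its Darboux frame with respect to $M$ is $\{\mathbf T,\mathbf Q,\mathbf n\}$ with $\mathbf T=\beta'$, $\mathbf n$ the unit normal of $M$ along $\beta$, and $\mathbf Q=\mathbf T\times_G\mathbf n$. The functions $\kappa_g=\mathbf T'\cdot_G\mathbf Q$, $\kappa_n=\mathbf T'\cdot_G\mathbf n$, $\tau_g=\mathbf Q'\cdot_G\mathbf n$ are the geodesic curvature, normal curvature and geodesic torsion. The symbol $\int g(x)\,dx$ denotes an antiderivative of $g$ on $I$. *)

(* Defs.v *)
From Stdlib Require Import Reals.
From Coquelicot Require Import Coquelicot.
Open Scope R_scope.

(* The topology and the vector space structure are Coquelicot's product
   structures, i.e. the usual ones of R^3. *)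
Definition G3 : Type := (R * R * R)%type.

Definition c1 (v : G3) : R := fst (fst v).
Definition c2 (v : G3) : R := snd (fst v).
Definition c3 (v : G3) : R := snd v.

Definition isotropic (v : G3) : Prop := c1 v = 0.

Definition gdot (v w : G3) : R :=
  if Req_EM_T (c1 v) 0 then
    if Req_EM_T (c1 w) 0 then c2 v * c2 w + c3 v * c3 w
    else c1 v * c1 w
  else c1 v * c1 w.

Definition gnorm (v : G3) : R := sqrt (Rabs (gdot v v)).

Definition gcross (v w : G3) : G3 :=
  (0, c3 v * c1 w - c1 v * c3 w, c1 v * c2 w - c2 v * c1 w).

Definition det3 (u v w : G3) : R :=
  c1 u * (c2 v * c3 w - c3 v * c2 w)
  - c2 u * (c1 v * c3 w - c3 v * c1 w)
  + c3 u * (c1 v * c2 w - c2 v * c1 w).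

Definition linearly_independent2 (v w : G3) : Prop :=
  forall s t : R, plus (scal s v) (scal t w) = zero -> s = 0 /\ t = 0.

Definition oint (a b : Rbar) (x : R) : Prop := Rbar_lt a x /\ Rbar_lt x b.

Definition constant_on (I : R -> Prop) (f : R -> R) : Prop :=
  exists c : R, forall x : R, I x -> f x = c.

Definition is_antiderivative (I : R -> Prop) (g G : R -> R) : Prop :=
  forall x : R, I x -> is_derive G x (g x).

Definition smooth1 (I : R -> Prop) (f : R -> G3) : Prop :=
  forall (n : nat) (x : R), I x ->
    ex_derive_n (fun t => c1 (f t)) n x /\
    ex_derive_n (fun t => c2 (f t)) n x /\
    ex_derive_n (fun t => c3 (f t)) n x.

Definition vderive (f : R -> G3) (x : R) : G3 :=
  (Derive (fun t => c1 (f t)) x,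
   Derive (fun t => c2 (f t)) x,
   Derive (fun t => c3 (f t)) x).

(* [ex_diff_n f n u v] says that the partial derivatives of [f] of order at
   most [n] exist and are continuous at (u, v). *)
Definition smooth2 (U : R * R -> Prop) (f : R * R -> G3) : Prop :=
  forall (n : nat) (u v : R), U (u, v) ->
    ex_diff_n (fun s t => c1 (f (s, t))) n u v /\
    ex_diff_n (fun s t => c2 (f (s, t))) n u v /\
    ex_diff_n (fun s t => c3 (f (s, t))) n u v.

Definition partial_u (phi : R * R -> G3) (q : R * R) : G3 :=
  vderive (fun t => phi (t, snd q)) (fst q).

Definition partial_v (phi : R * R -> G3) (q : R * R) : G3 :=
  vderive (fun t => phi (fst q, t)) (snd q).

Record local_parametrization
    (M : G3 -> Prop) (U : R * R -> Prop) (phi : R * R -> G3) : Prop := {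
  lp_open : open U;
  lp_smooth : smooth2 U phi;
  lp_regular : forall q, U q ->
    linearly_independent2 (partial_u phi q) (partial_v phi q);
  lp_admissible : forall q, U q ->
    ~ (isotropic (partial_u phi q) /\ isotropic (partial_v phi q));
  (* [phi] is a homeomorphism from [U] onto the relatively open part of [M]
     inside [V], with inverse [psi]. *)
  lp_homeo : exists (V : G3 -> Prop) (psi : G3 -> R * R),
    open V /\
    (forall q, U q -> M (phi q) /\ V (phi q) /\ psi (phi q) = q) /\
    (forall p, M p -> V p -> U (psi p) /\ phi (psi p) = p) /\
    (forall p, M p -> V p ->
       filterlim psi (within M (locally p)) (locally (psi p)))
}.

Definition chart_normal (phi : R * R -> G3) (q : R * R) : G3 :=
  let w := gcross (partial_u phi q) (partial_v phi q) in
  scal (/ gnorm w) w.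

(* An orientation of [M] is given by the smooth unit normal field [N] itself:
   since [chart_normal] never vanishes, smoothness of [N] makes the sign locally
   constant in every chart. *)
Record oriented_surface (M : G3 -> Prop) (N : G3 -> G3) : Prop := {
  os_charts : forall p, M p ->
    exists (U : R * R -> Prop) (phi : R * R -> G3) (q : R * R),
      local_parametrization M U phi /\ U q /\ phi q = p;
  os_normal : forall (U : R * R -> Prop) (phi : R * R -> G3),
    local_parametrization M U phi -> forall q, U q ->
      N (phi q) = chart_normal phi q \/
      N (phi q) = opp (chart_normal phi q);
  os_smooth : forall (U : R * R -> Prop) (phi : R * R -> G3),
    local_parametrization M U phi -> smooth2 U (fun q => N (phi q))
}.

Definition unit_speed_curve (I : R -> Prop) (beta : R -> G3) : Prop :=
  smooth1 I beta /\ forall x : R, I x -> c1 (beta x) = x.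

Definition curvature (beta : R -> G3) (x : R) : R :=
  gnorm (vderive (vderive beta) x).

Definition torsion (beta : R -> G3) (x : R) : R :=
  det3 (vderive beta x) (vderive (vderive beta) x)
       (vderive (vderive (vderive beta)) x)
  / (curvature beta x) ^ 2.

Definition darboux_T (beta : R -> G3) : R -> G3 := vderive beta.

Definition darboux_n (N : G3 -> G3) (beta : R -> G3) (x : R) : G3 :=
  N (beta x).

Definition darboux_Q (N : G3 -> G3) (beta : R -> G3) (x : R) : G3 :=
  gcross (darboux_T beta x) (darboux_n N beta x).

Definition geodesic_curvature (N : G3 -> G3) (beta : R -> G3) (x : R) : R :=
  gdot (vderive (darboux_T beta) x) (darboux_Q N beta x).

Definition normal_curvature (N : G3 -> G3) (beta : R -> G3) (x : R) : R :=
  gdot (vderive (darboux_T beta) x) (darboux_n N beta x).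

Definition asymptotic_curve
    (I : R -> Prop) (N : G3 -> G3) (beta : R -> G3) : Prop :=
  forall x : R, I x -> normal_curvature N beta x = 0.

Definition anti_Salkowski (I : R -> Prop) (beta : R -> G3) : Prop :=
  constant_on I (torsion beta) /\ ~ constant_on I (curvature beta).

(* Main.v *)
From Stdlib Require Import Reals Lra Ranalysis5.
From Coquelicot Require Import Coquelicot.
Require Import Defs.
Open Scope R_scope.

(* Write [A = y''] and [B = z''].  Both [T'] and the unit normal [n] are
    isotropic, so [kappa_n = 0] forces [(A, B) = kappa_g (- n3, n2)] and
    [|kappa_g| = kappa].  Constancy of the torsion [tau] says that [(A, B)]
    turns at constant rate [tau]: rotated back by the angle [tau x] and
    divided by its length [kappa], it is constant, whence
    [(A, B) = kappa (cos (tau x + t), sin (tau x + t))].  The normal is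
    continuous along the curve, so [kappa_g] keeps a constant sign, and this
    sign is absorbed in the phase [d1]; the frequency is [d = - tau]. *)

(** * Functions on open intervals with possibly infinite endpoints *)

Lemma open_oint (a b : Rbar) : open (oint a b).
Proof.
  exact (open_and _ _ (open_Rbar_gt a) (open_Rbar_lt b)).
Qed.

Lemma oint_inhabited (a b : Rbar) : Rbar_lt a b -> exists x : R, oint a b x.
Proof.
  unfold oint; destruct a as [a| |], b as [b| |]; simpl; intros hab;
    try contradiction.
  - exists ((a + b) / 2); lra.
  - exists (a + 1); split; [lra | exact I].
  - exists (b - 1); split; [exact I | lra].
  - exists 0; split; exact I.
Qed.

Lemma oint_convex (a b : Rbar) (x y t : R) :
  oint a b x -> oint a b y -> x <= t <= y -> oint a b t.
Proof.
  intros [hx _] [_ hy] [hxt hty]; split.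
  - apply Rbar_lt_le_trans with (Finite x); assumption.
  - apply Rbar_le_lt_trans with (Finite y); assumption.
Qed.

Lemma derive_zero_constant (a b : Rbar) (f : R -> R) :
  (forall x, oint a b x -> is_derive f x 0) ->
  forall x y, oint a b x -> oint a b y -> f x = f y.
Proof.
  intros hf.
  assert (hlt : forall x y, oint a b x -> oint a b y -> x < y -> f x = f y).
  { intros x y hx hy hxy; apply (eq_is_derive f); [|exact hxy].
    intros t ht; apply hf; exact (oint_convex a b x y t hx hy ht). }
  intros x y hx hy; destruct (Rtotal_order x y) as [h|[h|h]].
  - now apply hlt.
  - now rewrite h.
  - symmetry; now apply hlt.
Qed.

Lemma nonvanishing_constant_sign (a b : Rbar) (f : R -> R) :
  (forall x, oint a b x -> continuous f x) ->
  (forall x, oint a b x -> f x <> 0) ->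
  forall x y, oint a b x -> oint a b y -> 0 < f x * f y.
Proof.
  intros hc hnz.
  assert (hlt : forall x y, oint a b x -> oint a b y -> x < y ->
                0 < f x * f y).
  { intros x y hx hy hxy.
    destruct (Rlt_le_dec 0 (f x * f y)) as [h|h]; [exact h|exfalso].
    pose proof (hnz x hx) as hfx; pose proof (hnz y hy) as hfy.
    (* The factor [- f x] makes [g] negative at [x] and positive at [y] whatever the sign of [f x],
       which is the orientation that [IVT_interv] expects. *)
    set (g := fun t => - f x * f t).
    assert (hg : forall t, x <= t <= y -> continuity_pt g t).
    { intros t ht; apply continuity_pt_mult.
      - now apply continuity_pt_const.
      - apply continuity_pt_filterlim.
        apply hc; exact (oint_convex a b x y t hx hy ht). }
    assert (hprod : f x * f y <> 0) by now apply Rmult_integral_contrapositive.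
    destruct (IVT_interv g x y hg hxy) as [z [hz hgz]]; unfold g in *.
    - nra.
    - lra.
    - apply Rmult_integral in hgz; destruct hgz as [h0|h0]; [lra|].
      exact (hnz z (oint_convex a b x y z hx hy hz) h0). }
  intros x y hx hy; destruct (Rtotal_order x y) as [h|[h|h]].
  - now apply hlt.
  - subst y; pose proof (hnz x hx); nra.
  - rewrite Rmult_comm; now apply hlt.
Qed.

(** * Plane vectors turning at a constant rate *)

Lemma unit_vector_angle (c s : R) :
  c * c + s * s = 1 -> exists t : R, c = cos t /\ s = sin t.
Proof.
  intros h.
  assert (hc : -1 <= c <= 1) by nra.
  assert (hs : sin (acos c) = Rabs s).
  { rewrite sin_acos by exact hc.
    replace (1 - c²) with (s²) by (unfold Rsqr; lra).
    apply sqrt_Rsqr_abs. }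
  (* [acos] takes values in [0, PI], where the sine is nonnegative; a negative [s] is reached by the
     opposite angle. *)
  destruct (Rle_dec 0 s) as [h0|h0].
  - exists (acos c); rewrite cos_acos, hs by exact hc.
    now rewrite Rabs_right by lra.
  - exists (- acos c); rewrite cos_neg, sin_neg, cos_acos, hs by exact hc.
    rewrite Rabs_left by lra; lra.
Qed.

(** The quotient is the first coordinate of (A, B) after rotation by [- tau * u] and division by its
    length. The hypothesis on [k x * dk] is half the derivative of k^2 = A^2 + B^2. One coordinate
    is enough: the second one is the same expression for the pair (B, -A). *)
Lemma rotated_component_derive (A B k : R -> R) (x dA dB dk tau : R) :
  is_derive A x dA -> is_derive B x dB -> is_derive k x dk ->
  k x <> 0 -> k x * k x = A x * A x + B x * B x ->
  k x * dk = A x * dA + B x * dB ->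
  A x * dB - B x * dA = tau * (A x * A x + B x * B x) ->
  is_derive (fun u => (A u * cos (tau * u) + B u * sin (tau * u)) / k u) x 0.
Proof.
  intros hA hB hk hk0 hk2 hkdk hrate.
  auto_derive.
  - repeat split; first [exact hk0 | eexists; eassumption].
  - replace (Derive (fun u => A u) x) with dA
      by (symmetry; now apply is_derive_unique).
    replace (Derive (fun u => B u) x) with dB
      by (symmetry; now apply is_derive_unique).
    replace (Derive (fun u => k u) x) with dk
      by (symmetry; now apply is_derive_unique).
    set (c := cos _); set (s := sin _).
    (* The quotient rule, expanded by [k x] so that [k] and [dk] enter the numerator only through
       k^2 and k k', which the hypotheses express by A and B. *)
    transitivity
      (((dA * c + dB * s + tau * (B x * c - A x * s)) * (k x * k x)
        - (A x * c + B x * s) * (k x * dk)) / (k x * k x * k x));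
      [field; exact hk0|].
    rewrite hkdk.
    (* The numerator is a combination of two factors, each of which vanishes: one by the turning
       rate, the other by k^2 = A^2 + B^2. *)
    replace (_ - _) with
      ((B x * c - A x * s) *
       (tau * (k x * k x) - (A x * dB - B x * dA))
       + (dA * c + dB * s) * (k x * k x - (A x * A x + B x * B x)))
      by ring.
    rewrite hrate, <- hk2; field; exact hk0.
Qed.

(** (A B' - B A') / (A^2 + B^2) is the derivative of the polar angle of (A, B). No continuous polar
    angle has to be constructed: the normalized vector rotated back, (P, Q), is constant, so an
    angle is chosen at a single point. *)
Lemma constant_turning_rate (a b : Rbar) (A B dA dB : R -> R) (tau : R) :
  Rbar_lt a b ->
  (forall x, oint a b x -> is_derive A x (dA x)) ->
  (forall x, oint a b x -> is_derive B x (dB x)) ->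
  (forall x, oint a b x -> 0 < A x * A x + B x * B x) ->
  (forall x, oint a b x ->
    A x * dB x - B x * dA x = tau * (A x * A x + B x * B x)) ->
  exists t : R, forall x, oint a b x ->
    A x = sqrt (A x * A x + B x * B x) * cos (tau * x + t) /\
    B x = sqrt (A x * A x + B x * B x) * sin (tau * x + t).
Proof.
  intros hab hA hB hpos hrate.
  set (k := fun x => sqrt (A x * A x + B x * B x)).
  assert (hk : forall x, oint a b x -> 0 < k x)
    by (intros x hx; apply sqrt_lt_R0, hpos, hx).
  assert (hk2 : forall x, oint a b x -> k x * k x = A x * A x + B x * B x)
    by (intros x hx; apply sqrt_sqrt; apply Rlt_le, hpos, hx).
  set (P := fun x => (A x * cos (tau * x) + B x * sin (tau * x)) / k x).
  set (Q := fun x => (B x * cos (tau * x) - A x * sin (tau * x)) / k x).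
  assert (hdk : forall x, oint a b x ->
    is_derive k x ((A x * dA x + B x * dB x) / k x)).
  { intros x hx; unfold k; auto_derive.
    - repeat split;
        first [eexists; apply hA, hx | eexists; apply hB, hx | apply hpos, hx].
    - replace (Derive (fun x0 => A x0) x) with (dA x)
        by (symmetry; apply is_derive_unique, hA, hx).
      replace (Derive (fun x0 => B x0) x) with (dB x)
        by (symmetry; apply is_derive_unique, hB, hx).
      pose proof (hk x hx) as h; unfold k in h; field; lra. }
  assert (hP : forall x, oint a b x -> is_derive P x 0).
  { intros x hx; pose proof (hk x hx) as h.
    apply (rotated_component_derive A B k x (dA x) (dB x)
             ((A x * dA x + B x * dB x) / k x)); auto; [lra|field; lra]. }
  assert (hQ : forall x, oint a b x -> is_derive Q x 0).
  { intros x hx; pose proof (hk x hx) as h; pose proof (hrate x hx) as er.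
    apply (is_derive_ext
      (fun u => (B u * cos (tau * u) + - A u * sin (tau * u)) / k u)).
    { intros u; unfold Q; f_equal; ring. }
    (* A quarter turn takes (A, B) to (B, -A) and preserves both the length and the turning rate. *)
    apply (rotated_component_derive B (fun u => - A u) k x (dB x) (- dA x)
             ((A x * dA x + B x * dB x) / k x)); auto; try lra.
    - now apply (is_derive_opp A), hA.
    - rewrite hk2 by exact hx; ring.
    - field; lra. }
  destruct (oint_inhabited a b hab) as [x0 hx0].
  assert (hcs : forall x, cos (tau * x) * cos (tau * x)
                          + sin (tau * x) * sin (tau * x) = 1).
  { intros x; pose proof (sin2_cos2 (tau * x)) as h; unfold Rsqr in h; lra. }
  destruct (unit_vector_angle (P x0) (Q x0)) as [t [hPt hQt]].
  { unfold P, Q; pose proof (hk x0 hx0) as h; pose proof (hk2 x0 hx0) as e2.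
    set (c := cos _); set (s := sin _).
    transitivity ((A x0 * A x0 + B x0 * B x0) * (c * c + s * s)
                  / (k x0 * k x0)); [field; lra|].
    unfold c, s; rewrite hcs, <- e2; field; lra. }
  exists t; intros x hx; fold (k x).
  rewrite cos_plus, sin_plus, <- hPt, <- hQt.
  (* The constants P and Q are now evaluated at [x] instead of [x0]; there the addition formulas
     undo the rotation. *)
  rewrite <- (derive_zero_constant a b P hP x x0 hx hx0).
  rewrite <- (derive_zero_constant a b Q hQ x x0 hx hx0).
  unfold P, Q; pose proof (hk x hx) as h; pose proof (hcs x) as h1.
  set (c := cos (tau * x)) in *; set (s := sin (tau * x)) in *.
  split.
  - transitivity (A x * (c * c + s * s)); [rewrite h1; ring | field; lra].
  - transitivity (B x * (c * c + s * s)); [rewrite h1; ring | field; lra].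
Qed.

(** * Isotropic vectors and the unit normal of the surface *)

Lemma gdot_isotropic (v w : G3) :
  isotropic v -> isotropic w -> gdot v w = c2 v * c2 w + c3 v * c3 w.
Proof.
  unfold isotropic, gdot; intros hv hw.
  destruct (Req_EM_T (c1 v) 0); [|contradiction].
  now destruct (Req_EM_T (c1 w) 0).
Qed.

Lemma gnorm_isotropic (v : G3) :
  isotropic v -> gnorm v = sqrt (c2 v * c2 v + c3 v * c3 v).
Proof.
  intros hv; unfold gnorm; rewrite (gdot_isotropic v v hv hv).
  rewrite Rabs_right; [reflexivity | nra].
Qed.

(** Ensures that [chart_normal] divides by a nonzero norm. If the cross product vanished, so would
    w1 v - v1 w; independence would give v1 = w1 = 0, and both vectors would be isotropic. *)
Lemma gcross_neq0 (v w : G3) :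
  linearly_independent2 v w -> ~ (isotropic v /\ isotropic w) ->
  0 < c2 (gcross v w) * c2 (gcross v w) + c3 (gcross v w) * c3 (gcross v w).
Proof.
  destruct v as [[v1 v2] v3], w as [[w1 w2] w3].
  unfold linearly_independent2, isotropic, gcross, c1, c2, c3; simpl.
  intros hli hiso.
  set (p := v3 * w1 - v1 * w3); set (q := v1 * w2 - v2 * w1).
  destruct (Req_dec p 0) as [hp|hp]; [|nra].
  destruct (Req_dec q 0) as [hq|hq]; [|nra].
  exfalso; apply hiso.
  (* The combination w1 v - v1 w has components 0, -q and p. *)
  destruct (hli w1 (- v1)) as [h1 h2]; [|lra].
  unfold plus, scal, zero; simpl; unfold prod_plus, prod_scal, prod_zero; simpl.
  unfold plus, scal, zero; simpl; unfold prod_plus, prod_scal, prod_zero; simpl.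
  unfold plus, scal, zero; simpl; unfold mult; simpl.
  unfold p in hp; unfold q in hq; repeat f_equal; lra.
Qed.

Lemma c1_scal (s : R) (v : G3) : c1 (scal s v) = s * c1 v.
Proof. reflexivity. Qed.
Lemma c2_scal (s : R) (v : G3) : c2 (scal s v) = s * c2 v.
Proof. reflexivity. Qed.
Lemma c3_scal (s : R) (v : G3) : c3 (scal s v) = s * c3 v.
Proof. reflexivity. Qed.
Lemma c1_opp (v : G3) : c1 (opp v) = - c1 v.
Proof. reflexivity. Qed.
Lemma c2_opp (v : G3) : c2 (opp v) = - c2 v.
Proof. reflexivity. Qed.
Lemma c3_opp (v : G3) : c3 (opp v) = - c3 v.
Proof. reflexivity. Qed.

Lemma chart_normal_unit (M : G3 -> Prop) (U : R * R -> Prop)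
    (phi : R * R -> G3) (q : R * R) :
  local_parametrization M U phi -> U q ->
  isotropic (chart_normal phi q) /\
  c2 (chart_normal phi q) * c2 (chart_normal phi q)
  + c3 (chart_normal phi q) * c3 (chart_normal phi q) = 1.
Proof.
  intros hphi hq; unfold chart_normal; cbv zeta.
  pose proof (gcross_neq0 _ _ (lp_regular _ _ _ hphi q hq)
                (lp_admissible _ _ _ hphi q hq)) as hpos.
  assert (hiso : isotropic (gcross (partial_u phi q) (partial_v phi q)))
    by reflexivity.
  set (w := gcross _ _) in *.
  unfold isotropic; rewrite c1_scal, c2_scal, c3_scal, hiso.
  split; [ring|].
  rewrite gnorm_isotropic by exact hiso.
  pose proof (sqrt_lt_R0 _ hpos) as hr.
  pose proof (sqrt_sqrt _ (Rlt_le _ _ hpos)) as hrr.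
  set (r := sqrt _) in *.
  transitivity ((c2 w * c2 w + c3 w * c3 w) / (r * r)); [field; lra|].
  rewrite hrr; field; lra.
Qed.

Lemma surface_normal_unit (M : G3 -> Prop) (N : G3 -> G3) (p : G3) :
  oriented_surface M N -> M p ->
  isotropic (N p) /\ c2 (N p) * c2 (N p) + c3 (N p) * c3 (N p) = 1.
Proof.
  intros hM hp.
  destruct (os_charts _ _ hM p hp) as (U & phi & q & hphi & hq & <-).
  destruct (chart_normal_unit M U phi q hphi hq) as [hiso hunit].
  unfold isotropic in *.
  destruct (os_normal _ _ hM U phi hphi q hq) as [-> | ->].
  - now split.
  - rewrite c1_opp, c2_opp, c3_opp; split; lra.
Qed.

(* Near [x0], [N (beta x)] factors through the chart as
    [N (phi (psi (beta x)))]. *)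
Lemma surface_normal_continuous_along (M : G3 -> Prop) (N : G3 -> G3)
    (beta : R -> G3) (x0 : R) :
  oriented_surface M N ->
  locally x0 (fun x => M (beta x)) -> continuous beta x0 ->
  continuous (fun x => c2 (N (beta x))) x0 /\
  continuous (fun x => c3 (N (beta x))) x0.
Proof.
  intros hM hMb hc.
  assert (hM0 : M (beta x0)) by exact (locally_singleton _ _ hMb).
  destruct (os_charts _ _ hM _ hM0) as (U & phi & q & hphi & hq & hphiq).
  destruct (lp_homeo _ _ _ hphi) as (V & psi & hV & h1 & h2 & h3).
  destruct (h1 q hq) as (_ & hVq & hpsi); rewrite hphiq in hVq, hpsi.
  assert (hnear : locally x0 (fun x => M (beta x) /\ V (beta x))).
  { apply filter_and; [exact hMb|].
    apply hc, hV, hVq. }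
  (* The inverse chart [psi] has a limit only along [M], which suffices because [beta] stays in [M]
     near [x0]. *)
  assert (hlim : filterlim (fun x => psi (beta x)) (locally x0) (locally q)).
  { rewrite <- hpsi.
    apply filterlim_comp with (within M (locally (beta x0))).
    - intros P hP; unfold within in hP; unfold filtermap.
      specialize (hc _ hP); unfold filtermap in hc.
      apply filter_imp with (2 := filter_and _ _ hc hMb); tauto.
    - now apply h3. }
  assert (hgen : forall c : G3 -> R,
    continuity_2d_pt (fun s t => c (N (phi (s, t)))) (fst q) (snd q) ->
    continuous (fun x => c (N (beta x))) x0).
  { intros c hcN; apply continuity_2d_pt_filterlim in hcN.
    rewrite <- surjective_pairing, hphiq in hcN.
    apply (continuous_ext_loc (fun x => c (N (beta x)))
             (fun x => c (N (phi (fst (psi (beta x)), snd (psi (beta x))))))).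
    - apply filter_imp with (2 := hnear); intros x [hx1 hx2].
      rewrite <- surjective_pairing.
      now rewrite (proj2 (h2 _ hx1 hx2)).
    - unfold continuous.
      rewrite <- surjective_pairing, hpsi, hphiq.
      exact (filterlim_comp _ _ _ (fun x => psi (beta x))
               (fun z => c (N (phi (fst z, snd z)))) _ _ _ hlim hcN). }
  destruct q as [q1 q2].
  (* Order 0 of [ex_diff_n] is exactly continuity at the point. *)
  destruct (os_smooth _ _ hM U phi hphi 0%nat q1 q2 hq)
    as (_ & [hN2 _] & [hN3 _]).
  split; apply hgen; assumption.
Qed.

(** * Regularity and derivatives of the curve *)

Lemma smooth1_continuous (I : R -> Prop) (f : R -> G3) (x : R) :
  smooth1 I f -> I x -> continuous f x.
Proof.
  intros hf hx; destruct (hf 1%nat x hx) as (d1 & d2 & d3); simpl in d1, d2, d3.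
  apply (ex_derive_continuous (V := R_NormedModule)) in d1, d2, d3.
  apply (continuous_ext (fun t => (c1 (f t), c2 (f t), c3 (f t)))).
  { intros t; now destruct (f t) as [[u v] w]. }
  intros P [eps hP]; unfold filtermap.
  apply filter_imp with
    (P := fun t => (ball (c1 (f x)) eps (c1 (f t)) /\
                    ball (c2 (f x)) eps (c2 (f t))) /\
                   ball (c3 (f x)) eps (c3 (f t))).
  { intros t h; apply hP, h. }
  apply filter_and; [apply filter_and|].
  - apply d1; now exists eps.
  - apply d2; now exists eps.
  - apply d3; now exists eps.
Qed.

(** The first coordinate is known only on the interval. Since the interval is open, each equality
    holds near the point and can be differentiated, once for each order. *)
Lemma unit_speed_derivatives (a b : Rbar) (beta : R -> G3) (x : R) :
  unit_speed_curve (oint a b) beta -> oint a b x ->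
  c1 (vderive beta x) = 1 /\
  isotropic (vderive (vderive beta) x) /\
  isotropic (vderive (vderive (vderive beta)) x).
Proof.
  intros [_ h0] hx.
  assert (h1 : forall t, oint a b t -> c1 (vderive beta t) = 1).
  { intros t ht; rewrite <- (Derive_id t); apply Derive_ext_loc.
    exact (locally_open _ _ (open_oint a b) h0 t ht). }
  assert (h2 : forall t, oint a b t -> c1 (vderive (vderive beta) t) = 0).
  { intros t ht; rewrite <- (Derive_const 1 t); apply Derive_ext_loc.
    exact (locally_open _ _ (open_oint a b) h1 t ht). }
  split; [now apply h1|split; [now apply h2|]].
  unfold isotropic; rewrite <- (Derive_const 0 x); apply Derive_ext_loc.
  exact (locally_open _ _ (open_oint a b) h2 x hx).
Qed.

(** * Recovering the curve from its geodesic curvature *)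

Theorem corollary4p11
  (M : G3 -> Prop) (N : G3 -> G3) (hM : oriented_surface M N)
  (a b : Rbar) (hab : Rbar_lt a b)
  (beta : R -> G3)
  (hbeta : unit_speed_curve (oint a b) beta)
  (hbetaM : forall x : R, oint a b x -> M (beta x))
  (hkappa : forall x : R, oint a b x -> 0 < curvature beta x)
  (hasym : asymptotic_curve (oint a b) N beta)
  (hanti : anti_Salkowski (oint a b) beta) :
  exists d d1 : R, exists Y1 Y Z1 Z : R -> R,
    is_antiderivative (oint a b)
      (fun x => geodesic_curvature N beta x * sin (d * x + d1)) Y1 /\
    is_antiderivative (oint a b) Y1 Y /\
    is_antiderivative (oint a b)
      (fun x => geodesic_curvature N beta x * cos (d * x + d1)) Z1 /\
    is_antiderivative (oint a b) Z1 Z /\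
    forall x : R, oint a b x -> beta x = (x, Y x, Z x).
Proof.
  destruct hanti as [[tau htau] _].
  set (y := fun x => c2 (beta x)); set (z := fun x => c3 (beta x)).
  set (A := Derive (Derive y)); set (B := Derive (Derive z)).
  set (n2 := fun x => c2 (N (beta x))); set (n3 := fun x => c3 (N (beta x))).
  assert (hd1 : forall x, oint a b x -> ex_derive y x /\ ex_derive z x)
    by (intros x hx; exact (proj2 (proj1 hbeta 1%nat x hx))).
  assert (hd2 : forall x, oint a b x ->
    ex_derive (Derive y) x /\ ex_derive (Derive z) x)
    by (intros x hx; exact (proj2 (proj1 hbeta 2%nat x hx))).
  assert (hd3 : forall x, oint a b x -> ex_derive A x /\ ex_derive B x)
    by (intros x hx; exact (proj2 (proj1 hbeta 3%nat x hx))).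
  assert (hT : forall x, oint a b x -> isotropic (vderive (vderive beta) x))
    by (intros x hx; apply (unit_speed_derivatives a b beta x hbeta hx)).
  assert (hk : forall x, oint a b x ->
    curvature beta x = sqrt (A x * A x + B x * B x)).
  { intros x hx; unfold curvature; now rewrite (gnorm_isotropic _ (hT x hx)). }
  assert (hpos : forall x, oint a b x -> 0 < A x * A x + B x * B x).
  { intros x hx; apply sqrt_lt_0_alt; rewrite sqrt_0, <- hk by exact hx.
    now apply hkappa. }
  (* T has first component 1 while T' and T'' are isotropic, so the determinant in the torsion
     reduces to A B' - B A', and its denominator is A^2 + B^2. *)
  assert (hrate : forall x, oint a b x ->
    A x * Derive B x - B x * Derive A x = tau * (A x * A x + B x * B x)).
  { intros x hx; rewrite <- (htau x hx); unfold torsion; rewrite hk by exact hx.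
    rewrite pow2_sqrt by (apply Rlt_le, hpos, hx).
    destruct (unit_speed_derivatives a b beta x hbeta hx) as (e1 & e2 & e3).
    unfold det3; rewrite e1, e2, e3.
    change (c2 (vderive (vderive beta) x)) with (A x).
    change (c3 (vderive (vderive beta) x)) with (B x).
    change (c2 (vderive (vderive (vderive beta)) x)) with (Derive A x).
    change (c3 (vderive (vderive (vderive beta)) x)) with (Derive B x).
    pose proof (hpos x hx); field; lra. }
  assert (hn : forall x, oint a b x ->
    isotropic (N (beta x)) /\ n2 x * n2 x + n3 x * n3 x = 1)
    by (intros x hx; exact (surface_normal_unit M N _ hM (hbetaM x hx))).
  assert (hkn : forall x, oint a b x -> A x * n2 x + B x * n3 x = 0).
  { intros x hx; rewrite <- (hasym x hx); symmetry.
    exact (gdot_isotropic _ _ (hT x hx) (proj1 (hn x hx))). }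
  (* Here Q = (0, -n3, n2), because T has first component 1 and the normal is isotropic. *)
  assert (hkg : forall x, oint a b x ->
    geodesic_curvature N beta x = B x * n2 x - A x * n3 x).
  { intros x hx.
    transitivity (A x * c2 (darboux_Q N beta x) + B x * c3 (darboux_Q N beta x)).
    { exact (gdot_isotropic _ (darboux_Q N beta x) (hT x hx) eq_refl). }
    destruct (unit_speed_derivatives a b beta x hbeta hx) as (e1 & _).
    change (c2 (darboux_Q N beta x)) with
      (c3 (vderive beta x) * c1 (N (beta x)) - c1 (vderive beta x) * n3 x).
    change (c3 (darboux_Q N beta x)) with
      (c1 (vderive beta x) * n2 x - c2 (vderive beta x) * c1 (N (beta x))).
    rewrite e1, (proj1 (hn x hx)); ring. }
  set (g := fun x => B x * n2 x - A x * n3 x).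
  (* Lagrange's identity for (A, B) and the unit vector (n2, n3); the subtracted square is that of
     the normal curvature, which is zero. *)
  assert (hg2 : forall x, oint a b x -> g x * g x = A x * A x + B x * B x).
  { intros x hx; pose proof (hkn x hx) as e; destruct (hn x hx) as [_ e1].
    transitivity ((A x * A x + B x * B x) * (n2 x * n2 x + n3 x * n3 x)
                  - (A x * n2 x + B x * n3 x) * (A x * n2 x + B x * n3 x)).
    - unfold g; ring.
    - rewrite e, e1; ring. }
  assert (hsign : forall x w, oint a b x -> oint a b w -> 0 < g x * g w).
  { apply nonvanishing_constant_sign.
    - intros x hx.
      destruct (surface_normal_continuous_along M N beta x hM) as [hc2 hc3].
      + exact (locally_open _ _ (open_oint a b) hbetaM x hx).
      + exact (smooth1_continuous _ _ x (proj1 hbeta) hx).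
      + unfold g; apply (continuous_minus (V := R_NormedModule)).
        * apply (continuous_mult (K := R_AbsRing)); [|exact hc2].
          apply (ex_derive_continuous (V := R_NormedModule)), (hd3 x hx).
        * apply (continuous_mult (K := R_AbsRing)); [|exact hc3].
          apply (ex_derive_continuous (V := R_NormedModule)), (hd3 x hx).
    - intros x hx e; pose proof (hg2 x hx) as h; pose proof (hpos x hx).
      rewrite e in h; lra. }
  destruct (constant_turning_rate a b A B (Derive A) (Derive B) tau hab)
    as [t ht]; try assumption.
  { intros x hx; apply Derive_correct, (hd3 x hx). }
  { intros x hx; apply Derive_correct, (hd3 x hx). }
  assert (hphase : exists d1, forall x, oint a b x ->
    A x = g x * sin (- tau * x + d1) /\ B x = g x * cos (- tau * x + d1)).
  { destruct (oint_inhabited a b hab) as [x0 hx0].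
    assert (habs : forall x, oint a b x ->
      sqrt (A x * A x + B x * B x) = Rabs (g x)).
    { intros x hx; rewrite <- hg2 by exact hx; apply sqrt_Rsqr_abs. }
    destruct (Rlt_le_dec 0 (g x0)) as [h0|h0].
    (* The frequency [- tau] and the shift by PI/2 exchange sine and cosine; here the curvature
       equals [g]. *)
    - exists (PI / 2 - t); intros x hx.
      replace (- tau * x + (PI / 2 - t)) with (PI / 2 - (tau * x + t)) by ring.
      rewrite sin_shift, cos_shift.
      rewrite <- (Rabs_right (g x)), <- habs by
        (try exact hx; pose proof (hsign x x0 hx hx0); nra).
      exact (ht x hx).
    (* Here the curvature is [- g], and shifting by -PI/2 instead of PI/2 changes the sign of both
       sine and cosine to compensate. *)
    - exists (- (PI / 2) - t); intros x hx.
      replace (- tau * x + (- (PI / 2) - t))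
        with (- (PI / 2 + (tau * x + t))) by ring.
      rewrite sin_neg, cos_neg, <- cos_sin.
      replace (cos (PI / 2 + (tau * x + t))) with (- sin (tau * x + t))
        by (rewrite (sin_cos (tau * x + t)); ring).
      destruct (ht x hx) as [eA eB]; rewrite habs in eA, eB by exact hx.
      rewrite Rabs_left in eA, eB by (pose proof (hsign x x0 hx hx0); nra).
      split; lra. }
  destruct hphase as [d1 hd].
  (* The antiderivatives are the coordinates of [beta] and their derivatives, so no constant of
     integration remains to be adjusted. *)
  exists (- tau), d1, (Derive y), y, (Derive z), z.
  split; [|split; [|split; [|split]]]; intros x hx.
  - rewrite hkg by exact hx; fold (g x).
    rewrite <- (proj1 (hd x hx)); apply Derive_correct, (hd2 x hx).
  - apply Derive_correct, (hd1 x hx).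
  - rewrite hkg by exact hx; fold (g x).
    rewrite <- (proj2 (hd x hx)); apply Derive_correct, (hd2 x hx).
  - apply Derive_correct, (hd1 x hx).
  - rewrite <- (proj2 hbeta x hx) at 2; unfold y, z.
    now destruct (beta x) as [[u v] w].
Qed.
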